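(* Let $m\ge 1$ and let $\phi:[0,1]^m\to[0,1]^m$ be a Lipschitz continuous map with Lipschitz constant $L_\phi$; let $\mathcal{K}f=f\circ\phi$ be the associated Koopman operator on $C([0,1]^m)$. Then, for any $f\in C([0,1]^m)$ and any $\mathbf{n}=(n_1,\dots,n_m)$ with positive integer entries, $$\|\mathcal{B}_\mathbf{n}\mathcal{K}f-\mathcal{K}f\|_\infty\leq\frac{3}{2}\left.\Omega_f\left(L_{\phi}\sqrt{\sum_{l=1}^m\frac{1}{n_l}}\right)\right|_{\phi([0,1]^m)}.$$
   Context: $C([0,1]^m)$ is the space of continuous complex-valued functions on $[0,1]^m$, with $\|f\|_\infty=\sup_{\mathbf{x}\in[0,1]^m}|f(\mathbf{x})|$; $\|\cdot\|$ is the Euclidean norm on $\mathbb{R}^m$. The Bernstein operator $\mathcal{B}_\mathbf{n}:C([0,1]^m)\to C([0,1]^m)$ is $$(\mathcal{B}_\mathbf{n}f)(\mathbf{x})=\mathcal{B}_\mathbf{n}(f;\mathbf{x})=\sum_{k_1=0}^{n_1}\cdots\sum_{k_m=0}^{n_m} f\left(\tfrac{k_1}{n_1},\dots,\tfrac{k_m}{n_m}\right)\prod_{l=1}^m b_{n_l,k_l}(x_l),\qquad b_{n,k}(x)=\binom{n}{k}x^k(1-x)^{n-k}.$$ A Lipschitz constant of $\phi$ is any real $L_\phi\ge0$ with $\|\phi(\mathbf{x})-\phi(\mathbf{y})\|\le L_\phi\|\mathbf{x}-\mathbf{y}\|$ for all $\mathbf{x},\mathbf{y}$. For $A\subseteq[0,1]^m$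 and $\delta\ge0$, the full modulus of continuity of $f$ evaluated over $A$ is $\Omega_f(\delta)|_A=\sup\{|f(\mathbf{x})-f(\mathbf{y})|:\mathbf{x},\mathbf{y}\in A,\ \|\mathbf{x}-\mathbf{y}\|\le\delta\}$. *)

(* Defs.v *)
From HB Require Import structures.
From mathcomp Require Export all_boot all_order all_algebra.
From mathcomp Require Export complex.
From mathcomp Require Export all_classical all_reals all_analysis.

Set Implicit Arguments.
Unset Strict Implicit.
Unset Printing Implicit Defensive.

Export Order.TTheory GRing.Theory Num.Theory.
Export numFieldNormedType.Exports.

Local Open Scope classical_set_scope.
Local Open Scope ring_scope.
Local Open Scope complex_scope.

Definition unit_cube (R : realType) (m : nat) : set 'rV[R]_m :=
  [set x | forall l : 'I_m, 0 <= x ord0 l <= 1].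
Arguments unit_cube : clear implicits.

(* An element of C([0,1]^m) is represented by a function on R^m whose
   restriction to the cube is continuous; its values elsewhere are irrelevant.
   The regular alias [R[i]^o] carries the topology of the complex modulus. *)
Definition continuous_on_cube (R : realType) (m : nat)
    (f : 'rV[R]_m -> R[i]) : Prop :=
  {within unit_cube R m, continuous (f : 'rV[R]_m -> R[i]^o)}.

(* The library's norm on ['rV[R]_m] is the sup norm, hence this definition. *)
Definition eucl_norm (R : realType) (m : nat) (x : 'rV[R]_m) : R :=
  Num.sqrt (\sum_(l < m) x ord0 l ^+ 2).

Definition lipschitz_constant (R : realType) (m : nat) (A : set 'rV[R]_m)
    (phi : 'rV[R]_m -> 'rV[R]_m) (L : R) : Prop :=
  0 <= L /\ (forall x y : 'rV[R]_m, A x -> A y ->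
    eucl_norm (phi x - phi y) <= L * eucl_norm (x - y)).

(* The modulus of a complex number is [Normc.normc : R[i] -> R]; the
   generic [`|z|] takes its values in [R[i]]. The library's [sup] is 0 on
   sets that are empty or unbounded above; this does not occur below for
   continuous [f], [A] a nonempty subset of the cube and [delta >= 0]. *)
Definition sup_norm (R : realType) (m : nat) (f : 'rV[R]_m -> R[i]) : R :=
  sup [set Normc.normc (f x) | x in unit_cube R m].

Definition modulus_of_continuity (R : realType) (m : nat)
    (f : 'rV[R]_m -> R[i]) (A : set 'rV[R]_m) (delta : R) : R :=
  sup [set r | exists x y : 'rV[R]_m,
    [/\ A x, A y, eucl_norm (x - y) <= delta
      & r = Normc.normc (f x - f y)]].

Definition koopman (R : realType) (m : nat) (phi : 'rV[R]_m -> 'rV[R]_m)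
    (f : 'rV[R]_m -> R[i]) : 'rV[R]_m -> R[i] := f \o phi.

Definition bernstein_basis (R : realType) (n k : nat) (x : R) : R :=
  'C(n, k)%:R * x ^+ k * (1 - x) ^+ (n - k).

Definition bernstein_node (R : realType) (m : nat) (n : 'I_m -> nat)
    (k : {dffun forall l : 'I_m, 'I_(n l).+1}) : 'rV[R]_m :=
  \row_(l < m) ((k l)%:R / (n l)%:R).

(* The [m]-fold sum over 0 <= k_l <= n_l is one sum over multi-indices [k]. *)
Definition bernstein (R : realType) (m : nat) (n : 'I_m -> nat)
    (f : 'rV[R]_m -> R[i]) (x : 'rV[R]_m) : R[i] :=
  \sum_(k : {dffun forall l : 'I_m, 'I_(n l).+1})
    f (bernstein_node R k) *
    (\prod_(l < m) bernstein_basis (n l) (k l) (x ord0 l))%:C.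

(* Main.v *)
(* Under the product binomial law with parameters n_l and x_l, the random node
   k/n has mean square distance sum_l x_l(1-x_l)/n_l <= delta^2/4 to x, where
   delta^2 = sum_l 1/n_l.  Cutting the segment from x to the node into N equal
   pieces of length at most delta, with N <= 1 + t^2 and t the distance divided
   by delta, bounds the increment of f o phi by (1 + t^2) Omega, each piece
   contributing at most Omega = Omega_f(L delta) on the range of phi. The
   average is at most 5/4 Omega. *)
Require Import Defs.
From mathcomp Require Import ring lra.

Set Implicit Arguments.
Unset Strict Implicit.
Unset Printing Implicit Defensive.

Local Open Scope classical_set_scope.
Local Open Scope ring_scope.
Local Open Scope complex_scope.

(** * Products of sums with dependent index ranges *)

Lemma bigA_distr_dffun (R : Type) (zero one : R) (times : Monoid.mul_law zero)
    (plus : Monoid.add_law zero times) (I : finType) (T : I -> finType)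
    (F : forall i, T i -> R) :
  \big[times/one]_i \big[plus/zero]_(j : T i) F i j =
  \big[plus/zero]_(k : {dffun forall i, T i}) \big[times/one]_i F i (k i).
Proof.
(* Moving all the [T i] into one tagged union makes the distributive law for non-dependent functions
   apply; the choices that respect tags form [fprod T], which is in bijection with the dependent
   finite functions. *)
under eq_bigr do rewrite (big_tag (fun i => F i)).
rewrite (bigA_distr_big_dep (fun i => mem (tagged_with T i))).
rewrite (reindex (@dffun_of_fprod _ T)); last first.
  exact/onW_bij/dffun_of_fprod_bij.
transitivity (\big[plus/zero]_(k : fprod T)
    \big[times/one]_(i in I) [ffun j => F i j] (k i)).
  rewrite big_fprod; apply: eq_bigr => g _; apply: eq_bigr => i _.
  by congr untag; apply/funext => j; rewrite ffunE.
by apply: eq_bigr => k _; apply: eq_bigr => i _; rewrite !ffunE.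
Qed.

Arguments bigA_distr_dffun [R zero one times plus I T] F.

(** * Moments of the binomial law *)

Section BernsteinBasis.
Variable R : realType.
Implicit Types (n k : nat) (x a : R).

Lemma bernstein_basis_ge0 n k x : 0 <= x <= 1 -> 0 <= bernstein_basis n k x.
Proof.
move=> /andP[x0 x1]; rewrite /bernstein_basis !mulr_ge0 ?exprn_ge0//.
by rewrite subr_ge0.
Qed.

(** Pascal's rule, read as conditioning on one more trial: success shifts the index by one. With [u]
    arbitrary, every moment can be computed by induction on [n]. *)
Lemma sum_bernstein_basisS n x (u : nat -> R) :
  \sum_(k < n.+2) bernstein_basis n.+1 k x * u k =
  x * (\sum_(k < n.+1) bernstein_basis n k x * u k.+1) +
  (1 - x) * (\sum_(k < n.+1) bernstein_basis n k x * u k).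
Proof.
rewrite big_ord_recl /=.
have -> : \sum_(i < n.+1)
    bernstein_basis n.+1 (bump 0 i) x * u (bump 0 i) =
  \sum_(i < n.+1) x * (bernstein_basis n i x * u i.+1) +
  \sum_(i < n.+1) 'C(n, i.+1)%:R * x ^+ i.+1 * (1 - x) ^+ (n - i) * u i.+1.
  rewrite -big_split; apply: eq_bigr => i _ /=.
  rewrite /bernstein_basis /bump /= add1n binS natrD subSS exprS.
  by ring.
rewrite -mulr_sumr addrCA; congr (_ + _).
(* The top term vanishes since 'C(n, n+1) = 0; the others are the failure terms of positive index,
   and index 0 is the term split off first. *)
rewrite big_ord_recr /= bin_small// !mul0r addr0 [in RHS]big_ord_recl /=.
rewrite mulrDr mulr_sumr; congr (_ + _).
  by rewrite /bernstein_basis !bin0 !subn0 exprS; ring.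
apply: eq_bigr => i _.
rewrite /bernstein_basis /bump /= add1n.
rewrite (_ : (n - i)%N = (n - i.+1).+1); last first.
  by rewrite subnS prednK// subn_gt0.
by rewrite [(1 - x) ^+ _.+1]exprS; ring.
Qed.

Lemma sum_bernstein_basis n x : \sum_(k < n.+1) bernstein_basis n k x = 1.
Proof.
under eq_bigr do rewrite -[bernstein_basis _ _ _]mulr1.
elim: n => [|n IHn].
  by rewrite big_ord1 /bernstein_basis bin0 !expr0; ring.
by rewrite (sum_bernstein_basisS n x (fun=> 1)) IHn; ring.
Qed.

(** Variance plus squared bias. The centre [a] is free because the induction uses it at both [a] and
    [a - 1]. *)
Lemma sum_bernstein_basis_sqr n x a :
  \sum_(k < n.+1) bernstein_basis n k x * (k%:R - a) ^+ 2 =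
  n%:R * x * (1 - x) + (n%:R * x - a) ^+ 2.
Proof.
elim: n a => [|n IHn] a.
  by rewrite big_ord1 /= /bernstein_basis bin0 !expr0; ring.
rewrite (sum_bernstein_basisS n x (fun k => (k%:R - a) ^+ 2)) IHn.
have -> : \sum_(k < n.+1) bernstein_basis n k x * (k.+1%:R - a) ^+ 2 =
    \sum_(k < n.+1) bernstein_basis n k x * (k%:R - (a - 1)) ^+ 2.
  by apply: eq_bigr => k _; rewrite -natr1; ring.
by rewrite IHn -natr1; ring.
Qed.

Lemma bernstein_basis_variance n x : (0 < n)%N ->
  \sum_(k < n.+1) bernstein_basis n k x * (k%:R / n%:R - x) ^+ 2 =
  x * (1 - x) / n%:R.
Proof.
move=> n0; have nN0 : n%:R != 0 :> R by rewrite pnatr_eq0 -lt0n.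
transitivity ((\sum_(k < n.+1)
    bernstein_basis n k x * (k%:R - n%:R * x) ^+ 2) / n%:R ^+ 2).
  by rewrite mulr_suml; apply: eq_bigr => k _; field.
by rewrite sum_bernstein_basis_sqr; field.
Qed.

End BernsteinBasis.

(** * The product binomial law on the nodes *)

Section BernsteinWeights.
Variables (R : realType) (m : nat) (n : 'I_m -> nat).
Hypothesis n_gt0 : forall l, (0 < n l)%N.
Variable x : 'rV[R]_m.
Hypothesis x_cube : unit_cube R m x.

Local Notation multi_index := {dffun forall l : 'I_m, 'I_(n l).+1}.

Definition bernstein_weight (k : multi_index) : R :=
  \prod_(l < m) bernstein_basis (n l) (k l) (x ord0 l).

Lemma bernstein_weight_ge0 k : 0 <= bernstein_weight k.
Proof. by apply: prodr_ge0 => l _; apply: bernstein_basis_ge0. Qed.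

Lemma sum_bernstein_weight : \sum_k bernstein_weight k = 1.
Proof.
rewrite -(bigA_distr_dffun
  (fun l (j : 'I_(n l).+1) => bernstein_basis (n l) j (x ord0 l))).
by rewrite big1// => l _; exact: sum_bernstein_basis.
Qed.

Lemma bernstein_weight_variance (j : 'I_m) :
  \sum_k bernstein_weight k * (bernstein_node R k ord0 j - x ord0 j) ^+ 2 =
  x ord0 j * (1 - x ord0 j) / (n j)%:R.
Proof.
(* The squared deviation is absorbed into the [j]-th factor, so the sum factors and every other
   factor has total mass 1. *)
pose F l (i : 'I_(n l).+1) : R := bernstein_basis (n l) i (x ord0 l) *
  (if l == j then (i%:R / (n l)%:R - x ord0 l) ^+ 2 else 1).
transitivity (\sum_(k : multi_index) \prod_l F l (k l)).
  apply: eq_bigr => k _; rewrite big_split /=; congr (_ * _).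
  by rewrite (bigD1 j)//= eqxx big1 ?mulr1 ?mxE// => l /negPf ->.
rewrite -(bigA_distr_dffun F) (bigD1 j)//= [X in _ * X]big1 => [|l /negPf lj].
  by rewrite mulr1 /F eqxx bernstein_basis_variance.
by under eq_bigr do rewrite /F lj mulr1; exact: sum_bernstein_basis.
Qed.

Lemma bernstein_weight_mean_sqr :
  \sum_k bernstein_weight k * eucl_norm (bernstein_node R k - x) ^+ 2 <=
  (\sum_(l < m) (n l)%:R^-1) / 4.
Proof.
have -> : \sum_k bernstein_weight k * eucl_norm (bernstein_node R k - x) ^+ 2 =
    \sum_(l < m) x ord0 l * (1 - x ord0 l) / (n l)%:R.
  under [RHS]eq_bigr do rewrite -bernstein_weight_variance.
  rewrite exchange_big /=; apply: eq_bigr => k _.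
  rewrite /eucl_norm sqr_sqrtr ?sumr_ge0// => [|l _]; last exact: sqr_ge0.
  by rewrite mulr_sumr; apply: eq_bigr => l _; rewrite !mxE.
rewrite mulr_suml; apply: ler_sum => l _.
rewrite mulrC ler_pM2l ?invr_gt0 ?ltr0n//.
(* This is x(1 - x) <= 1/4, the source of the constant 4. *)
have := sqr_ge0 (x ord0 l - 2^-1); lra.
Qed.

Lemma bernstein_node_cube (k : multi_index) :
  unit_cube R m (bernstein_node R k).
Proof.
move=> l; rewrite mxE divr_ge0//= ler_pdivrMr ?ltr0n// mul1r ler_nat.
by rewrite -ltnS.
Qed.

End BernsteinWeights.

(** * Moduli, compactness and subdivision *)

Section Modulus.
Variables (R : realType) (m : nat).
Implicit Types (x y : 'rV[R]_m) (f : 'rV[R]_m -> R[i]).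

Lemma eucl_normZ (c : R) x : 0 <= c -> eucl_norm (c *: x) = c * eucl_norm x.
Proof.
move=> c0; rewrite /eucl_norm.
under eq_bigr do rewrite mxE exprMn.
by rewrite -mulr_sumr sqrtrM ?sqr_ge0// sqrtr_sqr ger0_norm.
Qed.

Lemma eucl_norm0 : eucl_norm (0 : 'rV[R]_m) = 0.
Proof. by rewrite -(scale0r (0 : 'rV_m)) eucl_normZ// mul0r. Qed.

Lemma normc_ge0 (z : R[i]) : 0 <= Normc.normc z.
Proof. by case: z => a b; exact: sqrtr_ge0. Qed.

Lemma normc_continuous : continuous (@Normc.normc R : R[i]^o -> R).
Proof.
move=> z.
apply/(@cvgrPdist_lt R R^o R[i]^o _ (nbhs_filter (z : R[i]^o))) => e e0.
apply/(@nbhs_normP _ R[i]^o); exists e%:C; first by rewrite /= ltcR.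
move=> w /=; rewrite -ltcR; apply: le_lt_trans.
(* Embedded in [R[i]], the claim becomes the reverse triangle inequality. *)
have -> : `|Normc.normc z - Normc.normc w|%:C = `| `|z| - `|w| | :> R[i].
  by rewrite -[`|z|]/(Normc.normc z)%:C -[`|w|]/(Normc.normc w)%:C -rmorphB
    normc_def /= expr0n addr0 sqrtr_sqr.
exact: ler_dist_dist.
Qed.

Lemma unit_cube_compact : compact (unit_cube R m).
Proof.
rewrite (_ : unit_cube R m = [set x | forall l, `[0, 1]%classic (x ord0 l)]).
  by apply: (rV_compact (A := fun=> _)) => _; exact: segment_compact.
by apply/seteqP; split=> x xP l; have := xP l; rewrite /= in_itv.
Qed.

Lemma unit_cube0 : unit_cube R m 0.
Proof. by move=> l; rewrite mxE lexx ler01. Qed.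

(** Extreme value theorem on the compact cube. The bound ensures that the [sup] in the modulus of
    continuity is a genuine upper bound, not the default 0. *)
Lemma continuous_on_cube_bounded f : continuous_on_cube f ->
  exists M, forall x, unit_cube R m x -> Normc.normc (f x) <= M.
Proof.
move=> cf.
have [|||c _ cmax] :=
  @compact_EVT_max _ R (@Normc.normc R \o f) (unit_cube R m).
- by exists 0; exact: unit_cube0.
- exact: unit_cube_compact.
- apply: (@within_continuous_comp R[i]^o) cf.
  by move=> z _; exact: normc_continuous.
- by exists (Normc.normc (f c)) => x xP; apply: cmax; rewrite inE.
Qed.

Lemma modulus_of_continuity_ge f (A : set 'rV[R]_m) d x y :
  continuous_on_cube f -> A `<=` unit_cube R m -> A x -> A y ->
  eucl_norm (x - y) <= d ->
  Normc.normc (f x - f y) <= modulus_of_continuity f A d.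
Proof.
move=> /continuous_on_cube_bounded[M fM] Acube Ax Ay xyd.
apply: ub_le_sup; last by exists x, y.
exists (M + M) => _ [u [v [Au Av _ ->]]].
rewrite (le_trans (le_normcD _ _))// normcN.
by rewrite lerD// fM//; exact: Acube.
Qed.

Lemma le_normc_telescope (u : nat -> R[i]) (w : R) (N : nat) :
  (forall i, (i < N)%N -> Normc.normc (u i.+1 - u i) <= w) ->
  Normc.normc (u N - u 0) <= N%:R * w.
Proof.
elim: N => [_|N IHN uw]; first by rewrite subrr Normc.normc0 mul0r.
rewrite (_ : u N.+1 - u 0 = (u N.+1 - u N) + (u N - u 0)); last first.
  by rewrite addrA subrK.
rewrite (le_trans (le_normcD _ _))// -natr1 mulrDl mul1r addrC lerD ?uw//.
by apply: IHN => i iN; apply: uw; exact: ltnW.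
Qed.

Lemma unit_cube_convex (t : R) x y : 0 <= t <= 1 ->
  unit_cube R m x -> unit_cube R m y -> unit_cube R m (x + t *: (y - x)).
Proof.
move=> /andP[t0 t1] xP yP l; rewrite !mxE.
have /andP[x0 x1] := xP l; have /andP[y0 y1] := yP l.
by apply/andP; split; nra.
Qed.

(** Take N = 1 if t <= 1; otherwise the integer part of t plus one, which is at most t + 1 <= t^2 +
    1. *)
Lemma natr_between_sqr (t : R) : 0 <= t ->
  exists N, [/\ (0 < N)%N, t <= N%:R & N%:R <= 1 + t ^+ 2].
Proof.
move=> t0; have [t1|t1] := leP t 1.
  by exists 1%N; split=> //; rewrite lerDl sqr_ge0.
have /andP[tl tu] := Num.Theory.truncn_itv t0.
exists (Num.truncn t).+1; split=> //; first exact: ltW.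
by rewrite -natr1; nra.
Qed.

End Modulus.

(** * Increments of the Koopman image *)

Lemma koopman_increment (R : realType) (m : nat)
    (phi : 'rV[R]_m -> 'rV[R]_m) (L : R)
    (hphi : forall x, unit_cube R m x -> unit_cube R m (phi x))
    (hL : lipschitz_constant (unit_cube R m) phi L)
    (f : 'rV[R]_m -> R[i]) (hf : continuous_on_cube f)
    (d : R) (x y : 'rV[R]_m) :
  0 < d -> unit_cube R m x -> unit_cube R m y ->
  Normc.normc (koopman phi f y - koopman phi f x) <=
  (1 + eucl_norm (y - x) ^+ 2 / d ^+ 2) *
    modulus_of_continuity f (phi @` unit_cube R m) (L * d).
Proof.
move=> d0 xP yP; set W := modulus_of_continuity _ _ _.
have [L0 Lip] := hL.
have WP u v : unit_cube R m u -> unit_cube R m v -> eucl_norm (u - v) <= d ->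
    Normc.normc (f (phi u) - f (phi v)) <= W.
  move=> uP vP uvd; apply: modulus_of_continuity_ge => //.
  - by move=> _ [z zP <-]; exact: hphi.
  - by rewrite (le_trans (Lip _ _ uP vP))// ler_wpM2l.
have W0 : 0 <= W.
  by rewrite (le_trans (normc_ge0 _) (WP x x _ _ _))// subrr eucl_norm0 ltW.
have [|N [N0 tN Nt]] := @natr_between_sqr _ (eucl_norm (y - x) / d).
  by rewrite divr_ge0 ?sqrtr_ge0// ltW.
rewrite expr_div_n in Nt.
apply: (@le_trans _ _ (N%:R * W)); last by rewrite ler_wpM2r.
have NN0 : N%:R != 0 :> R by rewrite pnatr_eq0 -lt0n.
(* The subdivision is made in the convex cube, before applying [phi]: the images then stay in the
   range of [phi], which need not be convex. *)
pose z i := x + (i%:R / N%:R) *: (y - x).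
have zP i : (i <= N)%N -> unit_cube R m (z i).
  move=> iN; apply: unit_cube_convex => //.
  by rewrite divr_ge0//= ler_pdivrMr ?ltr0n// mul1r ler_nat.
have -> : y = z N by rewrite /z divff// scale1r addrC subrK.
have -> : x = z 0 by rewrite /z mul0r scale0r addr0.
apply: (@le_normc_telescope _ (fun i => koopman phi f (z i))) => i iN.
apply: WP; [exact: zP|exact/zP/ltnW|].
rewrite (_ : z i.+1 - z i = N%:R^-1 *: (y - x)); last first.
  by rewrite /z opprD addrACA subrr add0r -scalerBl -mulrBl -natr1 addrAC subrr
    add0r mul1r.
by rewrite eucl_normZ ?invr_ge0// ler_pdivrMl ?ltr0n// -ler_pdivrMr.
Qed.

(** * Averaging the increments *)

Theorem theorem4p3 (R : realType) (m : nat) (hm : (1 <= m)%N)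
    (phi : 'rV[R]_m -> 'rV[R]_m) (L : R)
    (hphi : forall x, unit_cube R m x -> unit_cube R m (phi x))
    (hL : lipschitz_constant (unit_cube R m) phi L)
    (f : 'rV[R]_m -> R[i])
    (hf : continuous_on_cube f)
    (n : 'I_m -> nat) (hn : forall l, (0 < n l)%N) :
  sup_norm (bernstein n (koopman phi f) \- koopman phi f) <=
    3 / 2 * modulus_of_continuity f (phi @` unit_cube R m)
      (L * Num.sqrt (\sum_(l < m) (n l)%:R^-1)).
Proof.
set D := \sum_(l < m) _; set W := modulus_of_continuity _ _ _.
have D0 : 0 < D.
  rewrite /D (bigD1 (Ordinal hm))//= ltr_pwDl ?invr_gt0 ?ltr0n//.
  by apply: sumr_ge0 => l _; rewrite invr_ge0.
have incr u v : unit_cube R m u -> unit_cube R m v ->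
    Normc.normc (koopman phi f v - koopman phi f u) <=
    (1 + eucl_norm (v - u) ^+ 2 / D) * W.
  move=> uP vP; rewrite -[X in _ / X](sqr_sqrtr (ltW D0)).
  by apply: koopman_increment; rewrite ?sqrtr_gt0.
have W0 : 0 <= W.
  have := incr 0 0 (@unit_cube0 R m) (@unit_cube0 R m).
  by rewrite subrr Normc.normc0 subrr eucl_norm0 expr0n mul0r addr0 mul1r.
apply: ge_sup.
  by eexists; exists 0; [exact: unit_cube0|reflexivity].
move=> _ [x xP <-] /=.
pose p := @bernstein_weight R m n x.
(* As the weights sum to 1, the error is the mean increment from [x] to the nodes. *)
have -> : bernstein n (koopman phi f) x - koopman phi f x =
    \sum_k (koopman phi f (bernstein_node R k) - koopman phi f x) * (p k)%:C.
  under [RHS]eq_bigr do rewrite mulrBl.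
  by rewrite sumrB -mulr_sumr -rmorph_sum /= sum_bernstein_weight mulr1.
apply: (@le_trans _ _ (\sum_k (p k * W +
    p k * eucl_norm (bernstein_node R k - x) ^+ 2 * (W / D)))).
  elim/big_ind2 : _ => [|z1 r1 z2 r2 h1 h2|k _].
  - by rewrite Normc.normc0.
  - by rewrite (le_trans (le_normcD _ _))// lerD.
  - rewrite Normc.normcM.
    have p0 : 0 <= p k by exact: bernstein_weight_ge0.
    have -> : Normc.normc (p k)%:C = p k.
      by rewrite /Normc.normc /= expr0n addr0 sqrtr_sqr ger0_norm.
    have /(ler_wpM2r p0) := incr _ _ xP (bernstein_node_cube R hn k).
    move/le_trans; apply; rewrite le_eqVlt; apply/orP; left; apply/eqP.
    by field; rewrite gt_eqF.
rewrite big_split /= -!mulr_suml sum_bernstein_weight mul1r.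
have := bernstein_weight_mean_sqr hn x; rewrite -/D -/p => pD.
have /(ler_wpM2r) /(_ _ _ pD) : 0 <= W / D by rewrite divr_ge0// ltW.
(* The mean square term costs W/4, so the total is 5/4 W, at most 3/2 W as W >= 0. *)
have -> : D / 4 * (W / D) = W / 4 by field; rewrite gt_eqF.
by move: W0; lra.
Qed.
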